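(* Let $q\ge3$, let $g\in\mathbb{F}_q[t]$ be a non-constant square-free polynomial, and let $\ell$ be a prime factor of $q-1$. Let $P_1,\dots,P_s$ be all the monic irreducible factors of $g$ whose degrees do not divide $\deg g$, and assume $\deg P_i=\ell$ for all $1\le i\le s$. Then there exist infinitely many cyclic extensions $K$ of $\mathbb{F}_q(t)$ of degree $\ell$ whose discriminants are relatively prime to $g$ such that $g$ is Carmichael in $K$.
   Context: $\mathbb{F}_q$ is the finite field with $q$ elements. A finite ring $S$ is a Carmichael ring if $S$ is not a field and $a^{|S|}=a$ for every $a\in S$; an ideal $I$ of a ring $R$ is a Carmichael ideal if $R/I$ is a Carmichael ring. For a finite extension $K$ of $\mathbb{F}_q(t)$, $\mathcal{O}_K$ denotes the integral closure of $\mathbb{F}_q[t]$ in $K$, and an element $\alpha\in\mathcal{O}_K$ is Carmichael in $K$ if $\alpha\mathcal{O}_K$ is a Carmichael ideal of $\mathcal{O}_K$. The discriminant of $K$ is the discriminant ideal of $\mathcal{O}_K$ over $\mathbb{F}_q[t]$; ''relatively prime to $g$'' means no irreducible factor of $g$ divides it. *)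

(* Defs.v *)
From HB Require Import structures.
From mathcomp Require Import all_boot all_order all_algebra all_field.
Set Implicit Arguments. Unset Strict Implicit. Unset Printing Implicit Defensive.
Import GRing.Theory.
Local Open Scope ring_scope.

(* F_q(t) is {fraction {poly F}} for a finite field F; a finite extension K
   of F_q(t) is a fieldExtType over it. *)
Notation FqT F := {fraction {poly F}}.

Section FunctionFields.
Variable F : finFieldType.

Definition squarefree_poly (g : {poly F}) : Prop :=
  forall p : {poly F}, (1 < size p)%N -> ~~ (p * p %| g).

Definition frac_of (p : {poly F}) : FqT F := @FracField.tofrac _ p.

Section OverK.
Variable K : fieldExtType (FqT F).

Definition polyK (p : {poly F}) : K := (frac_of p)%:A.

Definition in_OK (x : K) : Prop :=
  exists p : {poly {poly F}}, p \is monic /\ root (map_poly polyK p) x.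

Definition congr_mod (alpha x y : K) : Prop :=
  exists c : K, in_OK c /\ x - y = alpha * c.

Definition quot_card (alpha : K) (N : nat) : Prop :=
  exists s : seq K, size s = N /\ (forall x, x \in s -> in_OK x) /\
    (forall i j, (i < N)%N -> (j < N)%N -> i <> j ->
        ~ congr_mod alpha (nth 0 s i) (nth 0 s j)) /\
    (forall x, in_OK x -> exists2 y, y \in s & congr_mod alpha x y).

Definition quot_is_field (alpha : K) : Prop :=
  ~ congr_mod alpha 1 0 /\
  forall x, in_OK x -> ~ congr_mod alpha x 0 ->
    exists y, in_OK y /\ congr_mod alpha (x * y) 1.

Definition carmichael_elt (alpha : K) : Prop :=
  in_OK alpha /\
  exists N, quot_card alpha N /\ ~ quot_is_field alpha /\
    forall a, in_OK a -> congr_mod alpha (a ^+ N) a.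

Definition trK (x : K) : FqT F :=
  \tr (passmx.mxof (vbasis fullv) (vbasis fullv) (amull x)).

Definition disc_tuple (xs : (\dim {:K}).-tuple K) : FqT F :=
  \det (\matrix_(i, j) trK (tnth xs i * tnth xs j)).

(* the discriminant ideal of O_K over F_q[t]: the ideal of F_q[t] generated
   by the discriminants of all (\dim K)-tuples of elements of O_K *)
Definition in_disc_ideal (d : {poly F}) : Prop :=
  exists s : seq ({poly F} * (\dim {:K}).-tuple K),
    (forall c, c \in s -> forall i, in_OK (tnth c.2 i)) /\
    frac_of d = \sum_(c <- s) frac_of c.1 * disc_tuple c.2.

Definition divides_disc (P : {poly F}) : Prop :=
  forall d, in_disc_ideal d -> P %| d.

Definition disc_coprime (g : {poly F}) : Prop :=
  forall P : {poly F}, irreducible_poly P -> P %| g -> ~ divides_disc P.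

Definition lfun_pow (s : 'End(K)) (i : nat) : 'End(K) :=
  iter i (fun f => (s \o f)%VF) \1%VF.

Definition cyclic_ext (n : nat) : Prop :=
  \dim {:K} = n /\
  exists s : 'End(K), kAut 1 fullv s /\
    lfun_pow s n = \1%VF /\
    (forall i, (0 < i < n)%N -> lfun_pow s i <> \1%VF) /\
    (forall t : 'End(K), kAut 1 fullv t -> exists2 i, (i < n)%N & t = lfun_pow s i).

End OverK.

Definition ext_iso (K1 K2 : fieldExtType (FqT F)) : Prop :=
  exists f : 'Hom(K1, K2), ahom_in fullv f /\ limg f = fullv.

End FunctionFields.

(* Main.v *)
(** Take [K = F_q(t)(y)] with [y ^+ l = D], where [D] is congruent to [1] modulo
    [g] and [deg D] is prime to [l].  Since [F_q] contains the [l]-th roots of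
    unity, this is a cyclic extension, of degree [l] because a factor of degree
    [m] of [X^l - D] makes [D ^+ m] an [l]-th power.  The isotypic components of an
    integral element are integral, which shows that [D] multiplies [O_K] into
    [F_q[t][y]]; hence [1, y, ..., y^(l-1)] is a basis of [O_K / g] over
    [F_q[t] / g].  The discriminant of this basis divides a power of [l D], and
    [(y - 1) (1 + y + ... + y^(l-1)) = D - 1] exhibits zero divisors.  With
    [N = q^(l deg g)], the map [a |-> a^N] on [O_K / g] is additive, fixes [y]
    because [l] divides [N - 1], and fixes [F_q[t]] because [g] is square-free and
    the degree of each of its prime factors divides [l deg g].

    As in Euclid's proof, there are infinitely many pairwise coprime such [D].
    By Kummer theory, an isomorphism between two of the extensions would give
    [D1 = c ^+ l * D2 ^+ k], which for coprime [D1], [D2] forces [l] to divide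
    [deg D1]. *)
Require Import Defs.
From HB Require Import structures.
From mathcomp Require Import all_boot all_order all_fingroup all_algebra all_solvable all_field.
From mathcomp Require Import zify.
Set Implicit Arguments. Unset Strict Implicit. Unset Printing Implicit Defensive.
Import GRing.Theory.
Local Open Scope ring_scope.

(** * Kummer extensions *)

(* If [q] divides [X^n - a], then the companion matrix [C] of [q] satisfies
   [C^n = a]; take determinants. *)
Lemma XnsubC_factor_norm (E : fieldType) (n : nat) (a : E) (q : {poly E}) :
  (0 < n)%N -> q %| 'X^n - a%:P -> exists b : E, b ^+ n = a ^+ (size q).-1.
Proof.
move=> n_gt0 dvq; have [q_le1|q_gt1] := leqP (size q) 1.
  by exists 1; rewrite expr1n; case: (size q) q_le1 => [|[]].
wlog mq: q dvq q_gt1 / q \is monic.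
  have lq0: (lead_coef q)^-1 != 0.
    by rewrite invr_eq0 lead_coef_eq0 -size_poly_gt0 ltnW.
  move=> /(_ ((lead_coef q)^-1 *: q)); rewrite dvdpZl // size_scale //; apply=> //.
  by rewrite monicE lead_coefZ mulVf // -invr_eq0.
(* Generalizing the size to [m] allows a case split: square matrices form a ring only in size
   [m.+1]. *)
have [m [C [Dm CK]]]: exists m (C : 'M[E]_m), m = (size q).-1 /\ char_poly C = q.
  by exists (size q).-1, (companionmx q); rewrite companionmxK.
case: m C Dm CK => [|m] C Dm CK; first by case: (size q) q_gt1 Dm => [|[]].
have C0: horner_mx C ('X^n - a%:P) = 0.
  case/dvdpP: dvq => r ->; rewrite rmorphM /= -CK.
  by rewrite Cayley_Hamilton mulr0.
have {C0} Cn: C ^+ n = a%:M.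
  by move: C0; rewrite rmorphB rmorphXn /= horner_mx_X horner_mx_C => /subr0_eq.
exists (\det C); rewrite -Dm -[RHS]det_scalar -Cn.
by elim: n {n_gt0 dvq Cn} => [|n IHn]; rewrite ?expr0 ?det1 // !exprS IHn det_mulmx.
Qed.

(** By [XnsubC_factor_norm], a factor of degree [m] strictly between 0 and [n] would make [a ^+ m]
    an [n]-th power. *)
Lemma XnsubC_irreducible (E : fieldType) (n : nat) (a : E) :
  (0 < n)%N ->
  (forall m b, (0 < m < n)%N -> b ^+ n <> a ^+ m) ->
  irreducible_poly ('X^n - a%:P).
Proof.
move=> n_gt0 nopow; have sz: size ('X^n - a%:P) = n.+1 by rewrite size_XnsubC.
split=> [|q q_n1 dvq]; first by rewrite sz.
have p0: 'X^n - a%:P != 0 by rewrite -size_poly_gt0 sz.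
have q0: q != 0 by apply: contraTneq dvq => ->; rewrite dvd0p.
have [b bn] := XnsubC_factor_norm n_gt0 dvq.
rewrite -dvdp_size_eqp // eqn_leq dvdp_leq //= sz ltnNge.
apply/negP => qn; apply: (nopow (size q).-1 b) => //.
move: q_n1 q0 qn; rewrite -size_poly_gt0; case: (size q) => [|[|k]] //= _ _.
Qed.

Lemma dvdn_add_inj (l i j k : nat) : (l %| j + i)%N -> (l %| j + k)%N ->
  (i < l)%N -> (k < l)%N -> i = k.
Proof.
move=> ji jk lt_il lt_kl; rewrite -(modn_small lt_il) -(modn_small lt_kl).
by apply/eqP; rewrite -(eqn_modDl j) (eqP ji) (eqP jk).
Qed.

Section KummerExtension.
Variables (E : fieldType) (K : fieldExtType E) (l : nat) (a z : E) (y : K).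
Hypothesis z_prim : l.-primitive_root z.
Hypothesis dimK : \dim {:K} = l.
Hypothesis yl : y ^+ l = a%:A.
Hypothesis genK : <<1; y>>%VS = fullv.
Hypothesis a_neq0 : a != 0.

Let l_gt0 : (0 < l)%N := prim_order_gt0 z_prim.

Lemma kummer_gen_neq0 : y != 0.
Proof.
by have := a_neq0; rewrite -(fmorph_eq0 (GRing.in_alg K)) /= -yl expf_eq0 l_gt0.
Qed.

Lemma kummer_adjoin_degree : adjoin_degree 1 y = l.
Proof.
by move: (dim_Fadjoin 1 y); rewrite genK dimK dimv1 muln1.
Qed.

Lemma kummer_minPoly : minPoly 1 y = 'X^l - (a%:A)%:P.
Proof.
have mP : 'X^l - (a%:A)%:P \is (@monic K) by rewrite monicXnsubC.
apply/eqP; rewrite -eqp_monic ?monic_minPoly // -dvdp_size_eqp.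
  by rewrite size_minPoly kummer_adjoin_degree size_XnsubC.
apply: minPoly_dvdp; last by rewrite rootE !hornerE yl subrr.
by rewrite rpredB ?rpredX ?polyOverX // polyOverC rpredZ // mem1v.
Qed.

Lemma kummer_expand x : exists c : 'I_l -> E, x = \sum_(i < l) c i *: y ^+ i.
Proof.
have [q Dq] := polyOver1P (Fadjoin_polyOver 1 y x).
exists (fun i : 'I_l => q`_i).
rewrite -[LHS](@Fadjoin_poly_eq _ _ 1%AS y) ?genK ?memvf //.
have := size_Fadjoin_poly 1 y x; rewrite kummer_adjoin_degree => sz.
rewrite (horner_coef_wide _ sz); apply: eq_bigr => i _.
by rewrite Dq coef_map /= mulr_algl.
Qed.

Lemma kummer_morphism : exists s : 'End(K), kAut 1 fullv s /\ s y = z *: y.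
Proof.
have idP1 : kHom 1 1%AS (\1%VF : 'End(K)) by exact: kHom1.
have rt : root (map_poly (\1%VF : 'End(K)) (minPoly 1 y)) (z *: y).
  rewrite (kHom_poly_id idP1) ?minPolyOver // kummer_minPoly rootE !hornerE.
  by rewrite exprZn (prim_expr_order z_prim) scale1r yl subrr.
exists (kHomExtend 1 \1 y (z *: y)); split.
  by rewrite kAutfE -genK (kHomExtendP (sub1v _) idP1 rt).
exact: (kHomExtend_val idP1 rt).
Qed.


Lemma kHom1_eq_gen (s t : 'End(K)) :
  kHom 1 fullv s -> kHom 1 fullv t -> s y = t y -> s = t.
Proof.
move=> /kHom_monoid_morphism[s1 sM] /kHom_monoid_morphism[t1 tM] sty.
have stX i : s (y ^+ i) = t (y ^+ i).
  by elim: i => [|i IHi]; rewrite ?expr0 ?s1 ?t1 // !exprS sM tM IHi sty.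
apply/lfunP=> x; have [c ->] := kummer_expand x.
by rewrite !linear_sum; apply: eq_bigr => i _; rewrite !linearZ /= stX.
Qed.

(** As [s] fixes [b], the quotient [s x / x] is an [l]-th root of unity, hence a power of [z]. Used
    for the generator [y] and, in the descent, for an arbitrary radical. *)
Lemma kHom1_radical (s : 'End(K)) (b : E) (x : K) :
  kHom 1 fullv s -> b != 0 -> x ^+ l = b%:A ->
  exists2 i : nat, (i < l)%N & s x = z ^+ i *: x.
Proof.
move=> /kHom_monoid_morphism[s1 sM] b_neq0 xl.
have x_neq0 : x != 0.
  by have := b_neq0; rewrite -(fmorph_eq0 (GRing.in_alg K)) /= -xl expf_eq0 l_gt0.
have sX i : s (x ^+ i) = s x ^+ i.
  by elim: i => [|i IHi]; rewrite ?expr0 ?s1 // !exprS sM IHi.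
have zA_prim : l.-primitive_root (z%:A : K).
  by rewrite (fmorph_primitive_root (GRing.in_alg K)).
have [|i Di] := prim_rootP zA_prim (x := s x / x).
  rewrite expr_div_n -sX xl linearZ /= s1 divff //.
  by rewrite (fmorph_eq0 (GRing.in_alg K)).
exists i => //; rewrite -(divfK x_neq0 (s x)) Di.
by rewrite -(rmorphXn (GRing.in_alg K)) /= mulr_algl.
Qed.

(** * Galois group, eigenspaces and trace of a Kummer extension *)

Section Generator.
Variable s : 'End(K).
Hypotheses (s_hom : kHom 1 fullv s) (sy : s y = z *: y).

Let s1 : s 1 = 1. Proof. by case/kHom_monoid_morphism: s_hom. Qed.
Let sM : {morph s : u v / u * v}.
Proof. by case/kHom_monoid_morphism: s_hom. Qed.

(** The iterate is the body of [lfun_pow], written out because the base field [E] is arbitrary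
    here. *)
Lemma kummer_iter_kHom i : kHom 1 fullv (iter i (fun f => (s \o f)%VF) \1%VF).
Proof. by elim: i => [|i IHi] /=; [exact: kHom1 | exact: comp_kHom]. Qed.

Lemma kummer_iterE i x : iter i (fun f => (s \o f)%VF) \1%VF x = iter i s x.
Proof. by elim: i => [|i IHi] /=; rewrite lfunE //= IHi. Qed.

Lemma kummer_iter_gen i : iter i s y = z ^+ i *: y.
Proof.
elim: i => [|i IHi] /=; first by rewrite expr0 scale1r.
by rewrite IHi linearZ /= sy scalerA exprSr.
Qed.

Lemma kummer_iter_basis i j : iter i s (y ^+ j) = z ^+ (i * j) *: y ^+ j.
Proof.
have sX x : s (x ^+ j) = s x ^+ j.
  by elim: (j) => [|k IHk]; rewrite ?expr0 ?s1 // !exprS sM IHk.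
have -> : iter i s (y ^+ j) = (iter i s y) ^+ j.
  by elim: i => //= i ->; rewrite sX.
by rewrite kummer_iter_gen exprZn exprM.
Qed.

Lemma kummer_gen_exp j : s (y ^+ j) = z ^+ j *: y ^+ j.
Proof. by have := kummer_iter_basis 1 j; rewrite mul1n. Qed.

Lemma kummer_orderP :
  iter l (fun f => (s \o f)%VF) \1%VF = \1%VF /\
  (forall i, (0 < i < l)%N -> iter i (fun f => (s \o f)%VF) \1%VF <> \1%VF).
Proof.
split=> [|i /andP[i_gt0 i_lt]].
  apply: kHom1_eq_gen; [exact: kummer_iter_kHom | exact: kHom1 |].
  by rewrite kummer_iterE kummer_iter_gen lfunE /= (prim_expr_order z_prim) scale1r.
move/(congr1 (fun f : 'End(K) => f y)); rewrite kummer_iterE kummer_iter_gen lfunE /=.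
move/eqP; rewrite -subr_eq0 -{2}[y]scale1r -scalerBl scaler_eq0.
rewrite (negPf kummer_gen_neq0) orbF subr_eq0 -(prim_order_dvd z_prim).
by rewrite gtnNdvd.
Qed.

Lemma kummer_Aut_iter (t : 'End(K)) : kHom 1 fullv t ->
  exists2 i, (i < l)%N & t = iter i (fun f => (s \o f)%VF) \1%VF.
Proof.
move=> t_hom; have [i lt_il ty] := kHom1_radical t_hom a_neq0 yl; exists i => //.
apply: kHom1_eq_gen => //; first exact: kummer_iter_kHom.
by rewrite kummer_iterE kummer_iter_gen.
Qed.

Lemma sum_prim_root m :
  \sum_(i < l) z ^+ (i * m) = if (l %| m)%N then l%:R else 0.
Proof.
have -> : \sum_(i < l) z ^+ (i * m) = \sum_(i < l) (z ^+ m) ^+ i.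
  by apply: eq_bigr => i _; rewrite mulnC exprM.
rewrite (prim_order_dvd z_prim); case: ifPn => [/eqP-> | zm].
  by under eq_bigr do rewrite expr1n; rewrite sumr_const card_ord.
have zm1 : z ^+ m - 1 != 0 by rewrite subr_eq0.
by apply: (mulfI zm1); rewrite mulr0 -subrX1 exprAC (prim_expr_order z_prim) expr1n subrr.
Qed.

(** Orthogonality of characters: averaging over the powers of [s] against the character inverse to
    that of [y ^+ k] kills every other monomial. The exponent [l - k] stands for [-k], and the
    average is left undivided by [l]. *)
Lemma kummer_projection (c : 'I_l -> E) (k : 'I_l) :
  \sum_(i < l) z ^+ (i * (l - k)) *: iter i s (\sum_(j < l) c j *: y ^+ j)
  = (l%:R * c k) *: y ^+ k.
Proof.
have lt_kl := ltn_ord k.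
have iterD i : iter i s (\sum_(j < l) c j *: y ^+ j)
             = \sum_(j < l) c j *: iter i s (y ^+ j).
  elim: i => //= i ->; rewrite linear_sum; apply: eq_bigr => j _.
  by rewrite linearZ.
transitivity (\sum_(j < l) (\sum_(i < l) z ^+ (i * (l - k + j))) * c j *: y ^+ j).
  transitivity (\sum_(i < l) \sum_(j < l)
      z ^+ (i * (l - k)) *: (c j *: iter i s (y ^+ j))).
    by apply: eq_bigr => i _; rewrite iterD scaler_sumr.
  rewrite exchange_big; apply: eq_bigr => j _; rewrite mulr_suml scaler_suml.
  apply: eq_bigr => i _; rewrite kummer_iter_basis !scalerA; congr (_ *: _).
  by rewrite mulnDr exprD mulrAC -mulrA mulrC.
rewrite (bigD1 k) //= sum_prim_root subnK 1?ltnW // dvdnn.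
rewrite big1 ?addr0 // => j ne_jk; rewrite sum_prim_root ifN ?mul0r ?scale0r //.
apply: contra ne_jk => dv; rewrite -val_eqE /= (@dvdn_add_inj l j (l - k) k) //.
by rewrite subnK ?dvdnn // ltnW.
Qed.

(** The projections recover each coefficient up to the factor [l], which is nonzero because [E] has
    a primitive [l]-th root of unity. *)
Lemma kummer_basis_inj (c d : 'I_l -> E) :
  \sum_(j < l) c j *: y ^+ j = \sum_(j < l) d j *: y ^+ j ->
  c =1 d.
Proof.
move=> eq_cd k; have := kummer_projection c k.
rewrite eq_cd kummer_projection // => /eqP; rewrite -subr_eq0 -scalerBl -mulrBr.
rewrite scaler_eq0 mulf_eq0 (negPf (prim_root_natf_neq0 z_prim)) expf_eq0.
by rewrite (negPf kummer_gen_neq0) andbF orbF subr_eq0 => /eqP.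
Qed.

(** The radical [x] is an eigenvector of [s], and the monomials [y ^+ j] with [j < l] have distinct
    eigenvalues [z ^+ j]. So [x] is a single monomial [c *: y ^+ m], whose [l]-th power is
    [c ^+ l * a ^+ m]. *)
Lemma kummer_root_descent (b : E) (x : K) : b != 0 -> x ^+ l = b%:A ->
  exists (c : E) (k : nat), b = c ^+ l * a ^+ k.
Proof.
move=> b_neq0 xl; have [m lt_ml sx] := kHom1_radical s_hom b_neq0 xl.
have [c Dx] := kummer_expand x.
have eq_c : \sum_(j < l) (c j * z ^+ j) *: y ^+ j = \sum_(j < l) (z ^+ m * c j) *: y ^+ j.
  transitivity (s x).
    rewrite Dx linear_sum; apply: eq_bigr => i _.
    by rewrite linearZ /= kummer_gen_exp scalerA.
  by rewrite sx {1}Dx scaler_sumr; apply: eq_bigr => i _; rewrite scalerA.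
have eigen j : c j != 0 -> j = m :> nat.
  move=> cj_neq0.
  have /= /eqP := kummer_basis_inj (c := fun j => c j * z ^+ j)
    (d := fun j => z ^+ m * c j) eq_c j.
  rewrite mulrC (inj_eq (mulIf cj_neq0)) (eq_prim_root_expr z_prim).
  by rewrite !modn_small // => /eqP.
pose m' := Ordinal lt_ml.
exists (c m'), m; apply: (fmorph_inj (GRing.in_alg K)) => /=.
rewrite -xl; have -> : x = c m' *: y ^+ m.
  rewrite Dx (bigD1 m') //= big1 ?addr0 // => i ne_im.
  have [->|/eigen Di] := eqVneq (c i) 0; first by rewrite scale0r.
  by case/eqP: ne_im; apply: val_inj; rewrite /= Di.
by rewrite exprZn exprAC yl -(rmorphXn (GRing.in_alg K)) /= scalerA.
Qed.

(** The formula of [trK] over a general base field. *)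
Let tr (x : K) : E :=
  \tr (passmx.mxof (vbasis fullv) (vbasis fullv) (amull x)).

(** Conjugating multiplication by [x] with [s] gives multiplication by [s x], and similar matrices
    have the same trace. *)
Lemma kummer_trace_invariant x : tr (s x) = tr x.
Proof.
pose M := passmx.mxof (vbasis {:K}) (vbasis {:K}).
have Bas := vbasisP {:K}.
have Dcomp : (amull (s x) \o s = s \o amull x)%VF.
  by apply/lfunP=> u; rewrite !lfunE /= !lfunE /= sM.
have /(congr1 M) : (s^-1 \o s = \1)%VF.
  by apply: lker0_compVf; apply: kAutf_lker0 s_hom.
rewrite /M (passmx.mxof_comp _ _ Bas) passmx.mxof1 ?(basis_free Bas) //.
rewrite -/M => SSi.
have := congr1 M Dcomp; rewrite /M !(passmx.mxof_comp _ _ Bas) -/M => DM.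
rewrite /tr -/M -[M (amull (s x))]mul1mx -(mulmx1C SSi) -mulmxA DM.
by rewrite mxtrace_mulC -mulmxA SSi mulmx1.
Qed.

Lemma kummer_traceZ c x : tr (c *: x) = c * tr x.
Proof.
rewrite /tr; have -> : amull (c *: x) = c *: amull x.
  by apply/lfunP=> u; rewrite !lfunE /= !lfunE /= scalerAl.
by rewrite (GRing.scalable_linear (passmx.mxof_linear _ _)) mxtraceZ.
Qed.

(** If [l] divides [m], the power is a scalar. Otherwise invariance under [s] gives [z ^+ m * t = t]
    for the trace [t], with [z ^+ m != 1]. *)
Lemma kummer_trace_gen m : tr (y ^+ m) = if (l %| m)%N then l%:R * a ^+ (m %/ l) else 0.
Proof.
case: ifPn => [dv | ndv].
  rewrite -{1}(divnK dv) mulnC exprM yl -(rmorphXn (GRing.in_alg K)) /= kummer_traceZ.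
  rewrite /tr; have -> : amull (1 : K) = \1%VF.
    by apply/lfunP=> u; rewrite !lfunE /= mul1r.
  by rewrite passmx.mxof1 ?(basis_free (vbasisP _)) // mxtrace1 dimK mulrC.
have := kummer_trace_invariant (y ^+ m).
rewrite kummer_gen_exp kummer_traceZ => /eqP.
rewrite -subr_eq0 -{2}[tr _]mul1r -mulrBl mulf_eq0 subr_eq0.
by rewrite -(prim_order_dvd z_prim) (negPf ndv) => /eqP.
Qed.

End Generator.

End KummerExtension.

(** * Polynomials and their fractions *)

Lemma clear_denominator (E : fieldType) (p n d : E) (i m : nat) :
  (i <= m)%N -> d != 0 -> p * n ^+ i * d ^+ (m - i) = d ^+ m * (p * (n / d) ^+ i).
Proof.
move=> le_im d0; have -> : d ^+ m = d ^+ (m - i) * d ^+ i by rewrite -exprD subnK.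
rewrite expr_div_n [RHS]mulrC [X in _ = X * _]mulrA mulrACA.
by rewrite mulVf ?mulr1 // expf_neq0.
Qed.

Section FractionsOfPolynomials.
Variable F : fieldType.
Local Notation tofrac := (@FracField.tofrac {poly F}).

Lemma frac_polyP (u : {fraction {poly F}}) :
  exists n d : {poly F}, [/\ d != 0, coprimep n d & u = tofrac n / tofrac d].
Proof.
have [n [d [d0 Du]]] : exists n d : {poly F}, d != 0 /\ u = tofrac n / tofrac d.
  elim/quotW: u => x; exists (frac x).1, (frac x).2.
  have x20 := denom_ratioP x; split=> //.
  apply: (@mulIf _ (tofrac (frac x).2)); rewrite ?tofrac_eq0 // divfK ?tofrac_eq0 //.
  rewrite !piE; apply/eqmodP => /=; rewrite FracField.equivfE /=.
  rewrite !numden_Ratio ?mulr1 ?oner_eq0 //.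
  by rewrite mulrC.
have g0 : gcdp n d != 0 by rewrite gcdp_eq0 (negPf d0) andbF.
exists (n %/ gcdp n d), (d %/ gcdp n d); split.
- by rewrite dvdp_div_eq0 ?dvdp_gcdr.
- by rewrite coprimep_div_gcd // d0 orbT.
rewrite Du; apply/eqP; rewrite eqr_div ?tofrac_eq0 ?dvdp_div_eq0 ?dvdp_gcdr //.
by rewrite -!tofracM tofrac_eq divp_mulA ?dvdp_gcdr // divp_mulAC ?dvdp_gcdl.
Qed.

Lemma tofrac_inj : injective tofrac.
Proof. by move=> p q /eqP; rewrite tofrac_eq => /eqP. Qed.

(** The rational root argument: with [u = n / d] in lowest terms, clearing denominators in a monic
    equation of degree [m] shows that [d] divides [n ^+ m], so [d] is constant. *)
Lemma poly_integrally_closed (u : {fraction {poly F}}) :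
  integralOver tofrac u -> exists p, u = tofrac p.
Proof.
case=> p mp; have [n [d [d0 cop ->]]] := frac_polyP u.
have fd0 : tofrac d != 0 by rewrite tofrac_eq0.
have [m sz] : exists m, size p = m.+1.
  by exists (size p).-1; rewrite prednK // size_poly_gt0 monic_neq0.
rewrite rootE horner_coef size_map_poly_id0; last first.
  by rewrite (monicP mp) tofrac1 oner_eq0.
rewrite sz => /eqP Hs.
have {Hs} : \sum_(i < m.+1) p`_i * n ^+ i * d ^+ (m - i) = 0.
  apply: tofrac_inj; rewrite tofrac0 -[RHS](mulr0 (tofrac d ^+ m)) -Hs mulr_sumr.
  rewrite rmorph_sum; apply: eq_bigr => i _.
  rewrite coef_map_id0 ?tofrac0 // !rmorphM !rmorphXn /=.
  by apply: clear_denominator; rewrite // -ltnS.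
rewrite big_ord_recr /= subnn expr0 mulr1.
have -> : p`_m = 1 by rewrite -(monicP mp) lead_coefE sz.
rewrite mul1r => /eqP; rewrite addrC addr_eq0 => /eqP nm.
have dn : d %| n ^+ m.
  rewrite nm dvdpNr; apply: (big_ind (fun v => d %| v)) => [|u1 u2|i _]; rewrite ?dvdp0 //.
    exact: dvdp_add.
  rewrite dvdp_mull // -[(m - i)%N]prednK ?subn_gt0 // exprS.
  exact: dvdp_mulr.
have : size d == 1%N.
  rewrite -dvdp1 -(@Gauss_dvdpr _ 1 (n ^+ m) d) ?mulr1 //.
  by rewrite coprimep_expr // coprimep_sym.
case/size_poly1P=> c c0 Dd; exists (c^-1 *: n).
apply: (mulIf fd0); rewrite divfK // -tofracM Dd -mul_polyC.
by congr tofrac; rewrite mulrC mulrA -polyCM divff // mul1r.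
Qed.

(** Writing [b = n / d] gives [n ^+ l = D ^+ m * d ^+ l]; comparing degrees, the prime [l] divides
    [m * deg D], although it divides neither factor. *)
Lemma tofrac_exp_neq_exp (l : nat) (D : {poly F}) :
  prime l -> D != 0 -> ~~ (l %| (size D).-1)%N ->
  forall m b, (0 < m < l)%N -> b ^+ l <> tofrac D ^+ m.
Proof.
move=> l_pr D0 lD m b /andP[m0 ml].
have [n [d [d0 _ ->]]] := frac_polyP b.
have fd0 : tofrac d != 0 by rewrite tofrac_eq0.
rewrite expr_div_n => /(canRL (divfK (expf_neq0 l fd0))).
rewrite -!tofracXn -tofracM => /tofrac_inj Dn.
have : (l %| (size D).-1 * m)%N.
  rewrite -(@dvdn_addl ((size d).-1 * l)) ?dvdn_mull // -!size_exp.
  have -> : ((size (D ^+ m)).-1 + (size (d ^+ l)).-1)%N = (size (n ^+ l)).-1.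
    have := size_mul (expf_neq0 m D0) (expf_neq0 l d0); rewrite -Dn.
    have := expf_neq0 m D0; have := expf_neq0 l d0; rewrite -!size_poly_gt0.
    by move: (size _) (size _) (size _) => x1 x2 x3; lia.
  by rewrite size_exp dvdn_mull.
rewrite Euclid_dvdM // (negPf lD) /= => /(dvdn_leq m0).
by rewrite leqNgt ml.
Qed.

(** With [c = n / d] in lowest terms, [D1 * d ^+ l = n ^+ l * D2 ^+ k], so [n ^+ l] divides [D1].
    The cofactor divides both [D1] and [D2 ^+ k], hence is constant, and [deg D1 = l * deg n]. *)
Lemma coprime_radical_degree (l k : nat) (D1 D2 : {poly F}) (c : {fraction {poly F}}) :
  (0 < l)%N -> D1 != 0 -> coprimep D1 D2 ->
  tofrac D1 = c ^+ l * tofrac D2 ^+ k -> (l %| (size D1).-1)%N.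
Proof.
move=> l0 D10 cop; have [n [d [d0 cnd ->]]] := frac_polyP c.
have fd0 : tofrac d != 0 by rewrite tofrac_eq0.
rewrite expr_div_n mulrAC => /(canLR (divfK (expf_neq0 l fd0))).
rewrite -!tofracXn -!tofracM => /tofrac_inj Dn.
have : n ^+ l %| D1.
  rewrite -(@Gauss_dvdpl _ _ (d ^+ l)) ?Dn ?dvdp_mulr //.
  by rewrite coprimep_expl // coprimep_expr.
case/dvdpP=> e De.
have n0 : n ^+ l != 0 by apply: contraNneq D10 => n0; rewrite De n0 mulr0.
have eD2 : e %| D2 ^+ k.
  apply/dvdpP; exists (d ^+ l); apply: (mulfI n0).
  by rewrite -Dn De mulrAC [RHS]mulrC [_ * e]mulrC.
have : size e == 1%N.
  rewrite -dvdp1 -(@Gauss_dvdpr _ 1 (D2 ^+ k) e) ?mulr1 //.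
  apply: coprimep_expr; apply: coprimep_dvdr cop.
  by rewrite De dvdp_mulr.
case/size_poly1P=> c0 c00 Ee.
rewrite De Ee mul_polyC size_scale // size_exp; exact: dvdn_mull.
Qed.

End FractionsOfPolynomials.

(** * Irreducible factors and square-free polynomials *)

(** Irreducibility is not decidable over a general field, so existence is stated as a double
    negation, proved by induction on the size. *)
Lemma irreducible_factor (F : fieldType) (f : {poly F}) :
  (1 < size f)%N -> ~ (forall P, irreducible_poly P -> ~~ (P %| f)).
Proof.
have [n] := ubnP (size f); elim: n => // n IHn in f *; rewrite ltnS => le_fn f_gt1.
have f0 : f != 0 by rewrite -size_poly_gt0 ltnW.
move=> noP; suff /noP : irreducible_poly f by rewrite dvdpp.
split=> // q q_n1 dvq; apply: contraT => q_nf.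
have q0 : q != 0 by apply: contraTneq dvq => ->; rewrite dvd0p.
have lt_qf : (size q < size f)%N.
  by rewrite ltn_neqAle dvdp_leq // andbT dvdp_size_eqp.
case: (IHn q) => [||P P_irr]; first exact: leq_trans lt_qf le_fn.
  by move: q_n1 q0; rewrite -size_poly_gt0; case: (size q) => [|[]].
by apply: contra (noP P P_irr) => /dvdp_trans; apply.
Qed.

(** Otherwise [g %/ gcdp g h] has an irreducible factor [P]; it divides [g], hence [h], hence the
    gcd, so [P * P] divides [g]. *)
Lemma dvdp_squarefree (F : fieldType) (g h : {poly F}) :
  (forall p : {poly F}, (1 < size p)%N -> ~~ (p * p %| g)) ->
  (forall P, irreducible_poly P -> P %| g -> P %| h) -> g %| h.
Proof.
move=> sqfree irr_dv; apply: contraT => ndv.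
have g0 : g != 0.
  apply/eqP=> g0; have := sqfree 'X; rewrite g0 dvdp0 size_polyX.
  by move/(_ isT).
have Dg : g = g %/ gcdp g h * gcdp g h by rewrite divpK ?dvdp_gcdl.
have f0 : g %/ gcdp g h != 0 by rewrite dvdp_div_eq0 ?dvdp_gcdl.
case: (@irreducible_factor _ (g %/ gcdp g h)) => [|P P_irr].
  rewrite ltn_neqAle eq_sym size_poly_gt0 f0 andbT; apply: contra ndv => f1.
  have /eqp_dvdl-> : g %= gcdp g h; last exact: dvdp_gcdr.
  by case/size_poly1P: f1 => c c0 Dc; rewrite {1}Dg Dc mul_polyC eqp_scale.
have P_gt1 : (1 < size P)%N by case: P_irr.
apply: contra (sqfree P P_gt1) => Pf; have Pg : P %| g by rewrite Dg dvdp_mulr.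
by rewrite Dg dvdp_mul // dvdp_gcd Pg irr_dv.
Qed.

(** * Polynomials over a finite field *)

Section FiniteField.
Variable F : finFieldType.

Lemma finField_prim_root (l : nat) :
  (0 < l)%N -> (l %| #|F|.-1)%N -> exists z : F, l.-primitive_root z.
Proof.
move=> l_gt0 ldv; pose rs := [seq x <- enum F | x != 0].
have card1 := finNzRing_gt1 F.
have : has (#|F|.-1).-primitive_root rs.
  apply: has_prim_root.
  - by case: #|F| card1 => [|[]].
  - apply/allP=> x; rewrite mem_filter => /andP[x0 _].
    rewrite unity_rootE; apply/eqP/(mulfI x0).
    by rewrite -exprS prednK ?expf_card ?mulr1 // ltnW.
  - by rewrite filter_uniq ?enum_uniq.
  rewrite -(cardC1 (0 : F)) cardE /enum_mem size_filter /rs size_filter.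
  by rewrite enumT; apply: eq_leq; apply: eq_count => x; rewrite /= inE.
by case/hasP=> w _ /dvdn_prim_root/(_ l ldv) wl; exists (w ^+ (#|F|.-1 %/ l)).
Qed.

(** Adjoining a root [w] of [P] gives a field with [#|F| ^ deg P] elements, each fixed by raising to
    the power [#|F| ^ m]. So [w] is a common root of both polynomials, and the irreducible [P]
    cannot be coprime to the other. *)
Lemma irreducible_dvdp_Frobenius (P r : {poly F}) (m : nat) :
  irreducible_poly P -> ((size P).-1 %| m)%N -> P %| r ^+ (#|F| ^ m) - r.
Proof.
move=> P_irr /dvdnP[k ->]; have [L dimL [w Pw _]] := irredp_FAdjoin P_irr.
have fermat (v : L) : v ^+ (#|F| ^ (size P).-1) = v.
  by apply/eqP; rewrite -dimL -(Fermat's_little_theorem {:L}%AS) memvf.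
have fermatk (v : L) : v ^+ (#|F| ^ (k * (size P).-1)) = v.
  rewrite mulnC expnM; elim: k => [|k IHk]; first by rewrite expn0 expr1.
  by rewrite expnS exprM fermat.
apply: contraLR (isT) => ndv.
have cop : coprimep P (r ^+ (#|F| ^ (k * (size P).-1)) - r).
  by rewrite irreducible_poly_coprime.
have := @coprimep_root _ (map_poly (GRing.in_alg L) P)
  (map_poly (GRing.in_alg L) (r ^+ (#|F| ^ (k * (size P).-1)) - r)) w.
rewrite coprimep_map => /(_ cop Pw).
by rewrite rmorphB rmorphXn /= hornerD hornerN horner_exp fermatk subrr eqxx.
Qed.

(** Euclid's construction: the new member is 1 plus a multiple of [g] and of all earlier members,
    with a power of ['X] adjusting the degree. *)
Lemma coprime_family (g : {poly F}) (l n : nat) :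
  (1 < size g)%N -> (1 < l)%N ->
  exists D : 'I_n -> {poly F},
    [/\ forall i, [/\ D i != 0, g %| D i - 1 & ~~ (l %| (size (D i)).-1)%N]
      & forall i j, i != j -> coprimep (D i) (D j)].
Proof.
move=> g_gt1 l_gt1; have g0 : g != 0 by rewrite -size_poly_gt0 ltnW.
elim: n => [|n [D [goodD copD]]]; first by exists (fun=> 1); split=> [[]|[]].
pose f := g * \prod_i D i.
have f0 : f != 0 by rewrite mulf_neq0 //; apply/prodf_neq0 => i _; case: (goodD i).
have f_gt1 : (1 < size f)%N.
  by apply: leq_trans g_gt1 (dvdp_leq f0 _); rewrite dvdp_mulr.
(* This exponent raises the degree to [l * deg f + 1], which is 1 modulo [l]. *)
pose e := (((size f).-1 * l.-1).+1)%N.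
pose D' := f * 'X^e + 1.
have szX : size (f * 'X^e) = ((size f).-1 * l).+2.
  rewrite size_mulXn // /e; move: f_gt1 l_gt1.
  by case: (size f) => // a; case: (l) => //= b _ _; nia.
have szD' : size D' = ((size f).-1 * l).+2 by rewrite size_polyDl // szX size_poly1.
have D'1 : D' - 1 = f * 'X^e by rewrite /D' addrK.
have good' : [/\ D' != 0, g %| D' - 1 & ~~ (l %| (size D').-1)%N].
  split; first by rewrite -size_poly_gt0 szD'.
    by rewrite D'1 -mulrA dvdp_mulr.
  by rewrite szD' /= -addn1 dvdn_addr ?dvdn_mull // dvdn1 neq_ltn l_gt1 orbT.
have cop' i : coprimep (D i) D'.
  have /dvdpP[h Dh] : D i %| D' - 1.
    by rewrite D'1 dvdp_mulr // dvdp_mull // (bigD1 i) //= dvdp_mulr.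
  have -> : D' = h * D i + 1 by rewrite -Dh subrK.
  by rewrite coprimep_addl_mul coprimep1.
exists (fun i => if unlift ord_max i is Some j then D j else D'); split.
  by move=> i; case: unliftP => [j|] _.
move=> i j; case: unliftP => [i'|] ->; case: unliftP => [j'|] ->; rewrite ?eqxx //.
- by rewrite (inj_eq (lift_inj (h:=ord_max))); apply: copD.
- by rewrite coprimep_sym.
Qed.

End FiniteField.

(** * Integral elements and congruences *)

Section IntegralClosure.
Variables (F : finFieldType) (K : fieldExtType (FqT F)).
Implicit Types (x u v : K) (p q : {poly F}).

HB.instance Definition _ := GRing.RMorphism.copy (polyK K)
  (GRing.in_alg K \o @FracField.tofrac {poly F}).

Lemma in_OKP x : in_OK x <-> integralOver (polyK K) x.
Proof. by split=> [[p [mp rp]] | [p mp rp]]; exists p. Qed.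

Lemma in_OK_polyK p : in_OK (polyK K p).
Proof. exact/in_OKP/integral_id. Qed.

Lemma in_OKD u v : in_OK u -> in_OK v -> in_OK (u + v).
Proof. by move=> /in_OKP ? /in_OKP ?; apply/in_OKP/integral_add. Qed.

Lemma in_OKB u v : in_OK u -> in_OK v -> in_OK (u - v).
Proof. by move=> /in_OKP ? /in_OKP ?; apply/in_OKP/integral_sub. Qed.

Lemma in_OKM u v : in_OK u -> in_OK v -> in_OK (u * v).
Proof. by move=> /in_OKP ? /in_OKP ?; apply/in_OKP/integral_mul. Qed.

Lemma in_OK1 : in_OK (1 : K).
Proof. exact/in_OKP/integral1. Qed.

Lemma in_OK0 : in_OK (0 : K).
Proof. exact/in_OKP/integral0. Qed.

Lemma in_OKX u n : in_OK u -> in_OK (u ^+ n).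
Proof.
by move=> uO; elim: n => [|n IHn]; rewrite ?exprS; [exact: in_OK1 | exact: in_OKM].
Qed.

Lemma in_OK_sum (I : finType) (f : I -> K) :
  (forall i, in_OK (f i)) -> in_OK (\sum_i f i).
Proof. by move=> fO; apply: big_ind => // *; [exact: in_OK0 | exact: in_OKD]. Qed.

(** The image is a root of the same monic polynomial, whose coefficients [s] fixes. *)
Lemma in_OK_kHom (s : 'End(K)) x : kHom 1 fullv s -> in_OK x -> in_OK (s x).
Proof.
move=> s_hom [p [mp rp]]; exists p; split=> //.
apply: (kHom_root_id (sub1v _) s_hom _ (memvf _) rp).
by apply/polyOverP => i; rewrite coef_map rpredZ // mem1v.
Qed.

Lemma in_OK_scalar (c : FqT F) : in_OK (c%:A : K) -> exists p, c = frac_of p.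
Proof.
case=> p [mp rp]; apply: poly_integrally_closed; exists p => //.
have -> : root (map_poly (@FracField.tofrac _) p) c =
  root (map_poly (GRing.in_alg K) (map_poly (@FracField.tofrac _) p)) (GRing.in_alg K c).
  by rewrite fmorph_root.
by rewrite -map_poly_comp.
Qed.

Variable alpha : K.

Lemma congr_mod_refl x : congr_mod alpha x x.
Proof. by exists 0; rewrite subrr mulr0; split=> //; apply: in_OK0. Qed.

Lemma congr_mod_sym u v : congr_mod alpha u v -> congr_mod alpha v u.
Proof.
case=> c [cO Dc]; exists (0 - c); split; first by apply: in_OKB => //; apply: in_OK0.
by rewrite sub0r mulrN -Dc opprB.
Qed.

Lemma congr_mod_trans v u x :
  congr_mod alpha u v -> congr_mod alpha v x -> congr_mod alpha u x.
Proof.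
move=> [c [cO Dc]] [d [dO Dd]]; exists (c + d); split; first exact: in_OKD.
by rewrite mulrDr -Dc -Dd addrA subrK.
Qed.

Lemma congr_modM u1 v1 u2 v2 : in_OK u1 -> in_OK v2 ->
  congr_mod alpha u1 v1 -> congr_mod alpha u2 v2 ->
  congr_mod alpha (u1 * u2) (v1 * v2).
Proof.
move=> u1O v2O [c [cO Dc]] [d [dO Dd]]; exists (u1 * d + c * v2).
split; first by apply: in_OKD; apply: in_OKM.
rewrite mulrDr mulrCA -Dd [alpha * (c * _)]mulrA -Dc mulrBr mulrBl.
by rewrite addrA subrK.
Qed.

Lemma congr_modX u v n : in_OK u -> in_OK v ->
  congr_mod alpha u v -> congr_mod alpha (u ^+ n) (v ^+ n).
Proof.
move=> uO vO uv; elim: n => [|n IHn]; first exact: congr_mod_refl.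
by rewrite !exprS; apply: congr_modM => //; apply: in_OKX.
Qed.

Lemma congr_mod_sum (I : finType) (f h : I -> K) :
  (forall i, congr_mod alpha (f i) (h i)) ->
  congr_mod alpha (\sum_i f i) (\sum_i h i).
Proof.
move=> fh; apply: (big_ind2 (congr_mod alpha)) => //; first exact: congr_mod_refl.
move=> u1 v1 u2 v2 [c [cO Dc]] [d [dO Dd]]; exists (c + d); split; first exact: in_OKD.
by rewrite mulrDr -Dc -Dd opprD addrACA.
Qed.

End IntegralClosure.

Lemma congr_mod_polyK (F : finFieldType) (K : fieldExtType (FqT F)) (g p q : {poly F}) :
  g %| p - q -> congr_mod (polyK K g) (polyK K p) (polyK K q).
Proof.
case/dvdpP=> h Dh; exists (polyK K h); split; first exact: in_OK_polyK.
by rewrite -rmorphB -rmorphM Dh mulrC.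
Qed.

(** * The extension of F_q(t) generated by an l-th root of D *)

Section KummerFunctionField.
Variables (F : finFieldType) (g D : {poly F}) (l : nat) (z : F).
Variables (K : fieldExtType (FqT F)) (y : K).
Hypothesis z_prim : l.-primitive_root z.
Hypothesis D_neq0 : D != 0.
Hypothesis g_gt1 : (1 < size g)%N.
Hypothesis gD : g %| D - 1.
Hypothesis dimK : \dim {:K} = l.
Hypothesis yl : y ^+ l = polyK K D.
Hypothesis genK : <<1; y>>%VS = fullv.

Let l_gt0 : (0 < l)%N := prim_order_gt0 z_prim.
Let zF : FqT F := frac_of z%:P.
Let g_neq0 : g != 0. Proof. by rewrite -size_poly_gt0 ltnW. Qed.

Let zF_prim : l.-primitive_root zF.
Proof. by rewrite (fmorph_primitive_root (@FracField.tofrac {poly F} \o polyC)). Qed.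

Let DF_neq0 : frac_of D != 0. Proof. by rewrite tofrac_eq0. Qed.

Let morphism_ex := kummer_morphism zF_prim dimK yl genK.

Lemma kummer_cyclic_ext : cyclic_ext K l.
Proof.
have [s [s_aut sy]] := morphism_ex.
have s_hom : kHom 1 fullv s by rewrite -kAutfE.
split=> //; exists s; split=> //.
have [pow1 pow_neq1] := kummer_orderP zF_prim dimK yl genK DF_neq0 s_hom sy.
split; first exact: pow1.
split; first exact: pow_neq1.
move=> t; rewrite kAutfE => t_hom.
exact: (kummer_Aut_iter zF_prim dimK yl genK DF_neq0 s_hom sy t_hom).
Qed.

Lemma kummer_function_field_descent (b : FqT F) (x : K) :
  b != 0 -> x ^+ l = b%:A -> exists c k, b = c ^+ l * frac_of D ^+ k.
Proof.
have [s [s_aut sy]] := morphism_ex.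
have s_hom : kHom 1 fullv s by rewrite -kAutfE.
exact: (kummer_root_descent zF_prim dimK yl genK DF_neq0 s_hom sy).
Qed.

(** The elements of the order [F_q[t][y]], which agrees with [O_K] up to the denominator [D]. *)
Definition coords (b : 'I_l -> {poly F}) : K := \sum_(i < l) polyK K (b i) * y ^+ i.

Lemma coordsE b : coords b = \sum_(i < l) frac_of (b i) *: y ^+ i.
Proof. by apply: eq_bigr => i _; rewrite mulr_algl. Qed.

Lemma in_OK_gen : in_OK y.
Proof.
exists ('X^l - D%:P); split; first exact: monicXnsubC.
rewrite rootE; have -> : map_poly (polyK K) ('X^l - D%:P) = 'X^l - (polyK K D)%:P.
  by rewrite rmorphB /= map_polyXn map_polyC.
by rewrite !hornerE yl subrr.
Qed.

Lemma in_OK_coords b : in_OK (coords b).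
Proof.
apply: in_OK_sum => i; apply: in_OKM; first exact: in_OK_polyK.
exact/in_OKX/in_OK_gen.
Qed.

Lemma coords_inj b c : coords b = coords c -> b =1 c.
Proof.
have [s [s_aut sy]] := morphism_ex.
have s_hom : kHom 1 fullv s by rewrite -kAutfE.
rewrite !coordsE => bc i; apply: tofrac_inj.
have := kummer_basis_inj zF_prim yl DF_neq0 s_hom sy
  (c := fun i => frac_of (b i)) (d := fun i => frac_of (c i)) bc.
by move/(_ i).
Qed.

Lemma coordsZ p b : polyK K p * coords b = coords (fun i => p * b i).
Proof.
rewrite mulr_sumr; apply: eq_bigr => i _.
by rewrite mulrA -rmorphM.
Qed.

Lemma coordsB b c : coords b - coords c = coords (fun i => b i - c i).
Proof.
rewrite -sumrB; apply: eq_bigr => i _.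
by rewrite -mulrBl -rmorphB.
Qed.

(* Each homogeneous component [c *: y ^+ k] of [x] is integral by the projection
   formula, so [c ^+ l * D ^+ k], hence also [(c * D) ^+ l], is a polynomial. *)
Lemma in_OK_coordsP x : in_OK x -> exists b, polyK K D * x = coords b.
Proof.
move=> xO; have [s [s_aut sy]] := morphism_ex.
have s_hom : kHom 1 fullv s by rewrite -kAutfE.
have [c Dx] := kummer_expand dimK genK x.
have coef k : exists b : {poly F}, frac_of D * c k = frac_of b.
  have := kummer_projection zF_prim s_hom sy c k; rewrite -Dx => Dproj.
  have compO : in_OK ((l%:R * c k) *: y ^+ k).
    rewrite -Dproj; apply: in_OK_sum => i; rewrite -mulr_algl; apply: in_OKM.
      rewrite -tofracXn; exact: in_OK_polyK.
    by elim: (i : nat) => //= j; apply: in_OK_kHom.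
  have : in_OK (((l%:R * c k) ^+ l * frac_of D ^+ k)%:A : K).
    have -> : ((l%:R * c k) ^+ l * frac_of D ^+ k)%:A = ((l%:R * c k) *: y ^+ k) ^+ l.
      rewrite exprZn exprAC yl /polyK -(rmorphXn (GRing.in_alg K)) /=.
      by rewrite scalerA.
    exact: in_OKX.
  case/in_OK_scalar=> p Dp.
  have [r Dr] : exists r, l%:R * c k * frac_of D = frac_of r.
    apply: poly_integrally_closed.
    exists ('X^l - (p * D ^+ (l - k))%:P); first exact: monicXnsubC.
    rewrite rootE rmorphB /= map_polyXn map_polyC /= !hornerE.
    rewrite exprMn tofracM tofracXn -/(frac_of p) -Dp -mulrA -exprD.
    by rewrite subnKC ?subrr // ltnW.
  (* The factor [l] left by the projection formula is a nonzero constant and can be divided out. *)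
  exists ((l%:R^-1)%:P * r); rewrite /frac_of tofracM -/(frac_of r) -Dr.
  have -> : FracField.tofrac (l%:R^-1)%:P = l%:R^-1 :> FqT F.
    rewrite -[LHS]/((@FracField.tofrac {poly F} \o polyC) l%:R^-1).
    by rewrite fmorphV rmorph_nat.
  rewrite -mulrA mulKf; first by rewrite mulrC.
  exact: prim_root_natf_neq0 zF_prim.
have [b Db] := fin_all_exists coef; exists b.
rewrite {1}Dx coordsE mulr_sumr; apply: eq_bigr => i _.
by rewrite -Db mulr_algl scalerA.
Qed.

(** If the difference is [g * x] with [x] integral, then [D * x] has polynomial coordinates, so [g]
    divides each [D * (b i - c i)]; and [g] is coprime to [D]. *)
Lemma congr_coords b c :
  congr_mod (polyK K g) (coords b) (coords c) <-> forall i, g %| b i - c i.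
Proof.
split=> [[x [xO]] | dv]; last first.
  apply: congr_mod_sum => i; apply: congr_modM; first exact: in_OK_polyK.
  - exact/in_OKX/in_OK_gen.
  - exact: congr_mod_polyK.
  - exact: congr_mod_refl.
have [d Dd] := in_OK_coordsP xO.
move/(congr1 (fun v => polyK K D * v)).
rewrite mulrCA Dd coordsB !coordsZ => /coords_inj eqb i.
have := eqb i => /= Db.
have cop : coprimep g D.
  have /dvdpP[h Dh] := gD.
  have -> : D = h * g + 1 by rewrite -Dh subrK.
  by rewrite coprimep_addl_mul coprimep1.
by rewrite -(Gauss_dvdpr _ cop) Db dvdp_mulr.
Qed.

(** As [D] is 1 modulo [g], [x] is congruent to [D * x], which lies in [F_q[t][y]]. *)
Lemma congr_coordsP x : in_OK x -> exists b, congr_mod (polyK K g) x (coords b).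
Proof.
move=> xO; have [b Db] := in_OK_coordsP xO; exists b; rewrite -Db.
rewrite -{1}[x]mul1r; apply: congr_modM => //; first exact: in_OK1.
  apply: congr_mod_sym; have -> : 1 = polyK K 1 :> K by rewrite rmorph1.
  exact: congr_mod_polyK.
exact: congr_mod_refl.
Qed.

(** Representatives are the vectors of [l] coordinates of degree below [deg g], encoded as matrices
    whose rows list the coefficients of one coordinate. *)
Lemma kummer_quot_card : quot_card (polyK K g) (#|F| ^ (l * (size g).-1)).
Proof.
pose d := (size g).-1.
pose f (A : 'M[F]_(l, d)) := coords (fun i => rVpoly (row i A)).
have szr (A : 'M[F]_(l, d)) i : (size (rVpoly (row i A)) < size g)%N.
  by rewrite -[ltnRHS]prednK ?ltnS ?size_poly // size_poly_gt0.
have f_inj A B : congr_mod (polyK K g) (f A) (f B) -> A = B.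
  move/congr_coords => AB; apply/row_matrixP => i; apply: (can_inj rVpolyK).
  apply/subr0_eq/eqP; apply: contraTT (AB i) => nz.
  rewrite gtNdvdp // (leq_ltn_trans (size_polyD _ _)) // size_polyN gtn_max.
  by rewrite !szr.
have szs : size [seq f A | A : 'M[F]_(l, d)] = (#|F| ^ (l * d))%N.
  by rewrite size_map -cardE card_mx.
exists [seq f A | A : 'M[F]_(l, d)]; split=> //; split.
  by move=> x /mapP[A _ ->]; apply: in_OK_coords.
split=> [i j lt_i lt_j ne_ij | x xO].
  have sze : size (enum 'M[F]_(l, d)) = (#|F| ^ (l * d))%N by rewrite -cardE card_mx.
  have nthE k : (k < #|F| ^ (l * d))%N ->
      nth 0 [seq f A | A : 'M[F]_(l, d)] k = f (nth 0 (enum 'M[F]_(l, d)) k).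
    by move=> lt_k; rewrite (nth_map 0) // sze.
  rewrite !nthE // => /f_inj/eqP.
  by rewrite nth_uniq ?enum_uniq ?sze // => /eqP.
have [b xb] := congr_coordsP xO.
exists (f (\matrix_(i < l, j < d) (b i %% g)`_j)); first by rewrite map_f ?mem_enum.
apply: congr_mod_trans xb _; apply/congr_coords => i.
have -> : rVpoly (row i (\matrix_(i < l, j < d) (b i %% g)`_j)) = b i %% g.
  rewrite -[RHS](@poly_rV_K _ d).
    by congr rVpoly; apply/rowP => j; rewrite !mxE.
  by rewrite -ltnS prednK ?ltn_modp // size_poly_gt0.
by rewrite {1}(divp_eq (b i) g) addrK dvdp_mull.
Qed.

Lemma kummer_quot_not_field : (1 < l)%N -> ~ quot_is_field (polyK K g).
Proof.
move=> l_gt1 [_ fld].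
pose o1 : 'I_l := Ordinal l_gt1; pose o0 : 'I_l := Ordinal l_gt0.
have Dy1 : y - 1 = coords (fun i => (i == o1)%:R - (i == o0)%:R).
  rewrite -coordsB; congr (_ - _); rewrite /coords.
    rewrite (bigD1 o1) //= big1 ?addr0 ?eqxx ?rmorph1 ?mul1r ?expr1 //.
    by move=> i /negPf->; rewrite rmorph0 mul0r.
  rewrite (bigD1 o0) //= big1 ?addr0 ?eqxx ?rmorph1 ?mul1r ?expr0 //.
  by move=> i /negPf->; rewrite rmorph0 mul0r.
have D0 : 0 = coords (fun=> 0).
  by rewrite /coords big1 // => i _; rewrite rmorph0 mul0r.
have DS : \sum_(i < l) y ^+ i = coords (fun=> 1).
  by apply: eq_bigr => i _; rewrite rmorph1 mul1r.
have g1 : ~~ (g %| 1) by rewrite dvdp1 neq_ltn g_gt1 orbT.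
have y1O : in_OK (y - 1) by rewrite Dy1; apply: in_OK_coords.
case: (fld (y - 1)) => // [|v [vO yv]].
  rewrite Dy1 D0 => /congr_coords/(_ o1).
  by rewrite eqxx subr0 -val_eqE /= subr0; apply/negP.
have SO : in_OK (\sum_(i < l) y ^+ i) by rewrite DS; apply: in_OK_coords.
(* An inverse [v] of [y - 1] would make its cofactor in [D - 1] vanish modulo [g], yet all
   coordinates of that cofactor are 1. *)
have : congr_mod (polyK K g) (\sum_(i < l) y ^+ i) 0.
  have yS : congr_mod (polyK K g) ((y - 1) * \sum_(i < l) y ^+ i) 0.
    rewrite -subrX1 yl -(rmorph1 (polyK K)) -rmorphB -(rmorph0 (polyK K)).
    by apply: congr_mod_polyK; rewrite subr0.
  apply: (@congr_mod_trans _ _ _ (v * ((y - 1) * \sum_(i < l) y ^+ i))).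
    rewrite mulrA -{1}[\sum_(i < l) _]mul1r [v * _]mulrC.
    apply: congr_modM => //; first exact: in_OK1; last exact: congr_mod_refl.
    exact: congr_mod_sym.
  rewrite -[X in congr_mod _ _ X](mulr0 v); apply: congr_modM => //.
    exact: in_OK0.
  exact: congr_mod_refl.
rewrite DS D0 => /congr_coords/(_ o0); rewrite subr0; exact/negP.
Qed.

Lemma kummer_congr_exp (m : nat) x :
  (l %| #|F|.-1)%N -> (forall r, g %| r ^+ (#|F| ^ m) - r) ->
  in_OK x -> congr_mod (polyK K g) (x ^+ (#|F| ^ m)) x.
Proof.
move=> lq g_frob xO; set N := (#|F| ^ m)%N.
have [b xb] := congr_coordsP xO; have bO := in_OK_coords b.
apply: (@congr_mod_trans _ _ _ (coords b ^+ N)); first exact: congr_modX.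
apply: congr_mod_trans (congr_mod_sym xb).
have N_gt0 : (0 < N)%N by rewrite expn_gt0 ltnW // finNzRing_gt1.
have Nchar : [pchar K].-nat N.
  (* [N] is a power of the characteristic, so raising to the power [N] is additive on [K]. *)
  have [p p_pr pF] := finPcharP F.
  have pK : p \in [pchar K].
    by rewrite (fmorph_pchar (polyK K \o polyC)).
  have pq : p.-nat #|F| by have := pprimeChar_pgroup pF; rewrite /pgroup cardsT.
  by rewrite (eq_pnat _ (pcharf_eq pK)) /N pnatX pq.
have expN_sum (h : 'I_l -> K) : (\sum_i h i) ^+ N = \sum_i h i ^+ N.
  apply: (big_morph (fun u : K => u ^+ N)) => [u v|]; first exact: exprDn_pchar.
  by rewrite expr0n gtn_eqF.
rewrite /coords expN_sum; apply: congr_mod_sum => i.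
rewrite exprMn -rmorphXn exprAC; apply: congr_modM.
- exact: in_OK_polyK.
- exact/in_OKX/in_OK_gen.
- exact: congr_mod_polyK.
apply: congr_modX; [exact/in_OKX/in_OK_gen | exact: in_OK_gen |].
(* Then [y ^+ N.-1] is a power of [y ^+ l = D], which is 1 modulo [g]. *)
have lN : (l %| N.-1)%N.
  apply: dvdn_trans lq _; rewrite -!subn1 /N -{2}(exp1n m) subn_exp.
  exact: dvdn_mulr.
rewrite -{1}(prednK N_gt0) exprS -[X in congr_mod _ _ X]mulr1; apply: congr_modM.
- exact: in_OK_gen.
- exact: in_OK1.
- exact: congr_mod_refl.
rewrite -(divnK lN) mulnC exprM yl -(expr1n _ (N.-1 %/ l)).
apply: congr_modX; [exact: in_OK_polyK | exact: in_OK1 |].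
by rewrite -(rmorph1 (polyK K)); apply: congr_mod_polyK.
Qed.

(** The discriminant of [1, y, ..., y^(l-1)] is the determinant of the trace matrix [M], whose
    entries vanish unless the indices add up to a multiple of [l]. Thus [M *m M] is diagonal, with
    entries built from [l] and [D] only, hence prime to [P]; squaring avoids the sign of the
    underlying permutation. *)
Lemma kummer_disc_coprime : disc_coprime K g.
Proof.
move=> P P_irr Pg Pdisc.
pose xs : (\dim {:K}).-tuple K := [tuple y ^+ i | i < \dim {:K}].
pose tr m : {poly F} := if (l %| m)%N then l%:R * D ^+ (m %/ l) else 0.
pose M : 'M[{poly F}]_(\dim {:K}) := \matrix_(i, j) tr (i + j)%N.
have [s [s_aut sy]] := morphism_ex.
have s_hom : kHom 1 fullv s by rewrite -kAutfE.
have trE m : trK (y ^+ m) = frac_of (tr m).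
  rewrite /trK (kummer_trace_gen zF_prim dimK yl s_hom sy) /tr.
  by case: ifP => _; rewrite /frac_of ?tofrac0 // tofracM tofracXn rmorph_nat.
have DM : disc_tuple xs = frac_of (\det M).
  rewrite /disc_tuple /frac_of -det_map_mx; congr (\det _).
  by apply/matrixP => i j; rewrite !mxE !tnth_mktuple -exprD trE.
have /Pdisc PdetM : in_disc_ideal K (\det M).
  exists [:: (1, xs)]; split=> [c|].
    rewrite inE => /eqP-> i; rewrite tnth_mktuple; exact/in_OKX/in_OK_gen.
  by rewrite big_seq1 DM /frac_of tofrac1 mul1r.
have copPD : coprimep P D.
  have /dvdpP[h Dh] := dvdp_trans Pg gD.
  have -> : D = h * P + 1 by rewrite -Dh subrK.
  by rewrite coprimep_addl_mul coprimep1.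
have lF_neq0 : l%:R != 0 :> F := prim_root_natf_neq0 z_prim.
have copPl : coprimep P l%:R.
  have -> : l%:R = l%:R *: 1 :> {poly F} by rewrite -mul_polyC mulr1 rmorph_nat.
  by rewrite coprimepZr // coprimep1.
have copPtr m : (l %| m)%N -> coprimep P (tr m).
  by rewrite /tr => ->; rewrite coprimepMr copPl coprimep_expr.
have lt_dim (i : 'I_(\dim {:K})) : (i < l)%N by rewrite -[ltnRHS]dimK.
have MM_diag : M *m M = diag_mx (\row_i (M *m M) i i).
  apply/matrixP => i k; rewrite !mxE; case: eqP => [->|ne_ik]; first by rewrite mulr1n.
  rewrite mulr0n big1 // => j _; rewrite !mxE /tr.
  case: ifP => [d1|]; last by rewrite mul0r.
  case: ifP => [d2|]; last by rewrite mulr0.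
  case: ne_ik; apply: val_inj => /=; move: (lt_dim i) (lt_dim k).
  by move: d1 d2; rewrite addnC => d1 d2; apply: dvdn_add_inj d1 d2.
have copMM i : coprimep P ((M *m M) i i).
  (* The only column meeting row [i] is [-i] modulo [l]; the remainder takes care of [i = 0]. *)
  have lt_j : ((l - i) %% l < \dim {:K})%N by rewrite [ltnRHS]dimK ltn_mod.
  rewrite mxE (bigD1 (Ordinal lt_j)) //= big1 => [|j ne_j].
    rewrite addr0 !mxE /= [((l - i) %% l + i)%N]addnC coprimepMr.
    have dv : (l %| i + (l - i) %% l)%N.
      by rewrite /dvdn modnDmr subnKC ?modnn // ltnW.
    by rewrite copPtr.
  rewrite !mxE {1}/tr ifN ?mul0r //; apply: contra ne_j => dv; rewrite -val_eqE /=.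
  apply/eqP; rewrite -(modn_small (lt_dim j)); apply/eqP.
  by rewrite -(eqn_modDl i) subnKC 1?ltnW // modnn.
have : coprimep P (\det (M *m M)).
  rewrite MM_diag det_diag.
  apply: (big_ind (fun v => coprimep P v)) => [|u v|i _]; first exact: coprimep1.
    by rewrite coprimepMr => -> ->.
  by rewrite mxE.
rewrite det_mulmx coprimepMr => /andP[copP _].
have [P_gt1 _] := P_irr; have := coprimepP _ _ copP P (dvdpp P) PdetM.
by rewrite -size_poly_eq1 gtn_eqF.
Qed.

End KummerFunctionField.

(** * Existence of the extensions and pairwise non-isomorphism *)

Lemma kummer_function_field_exists (F : finFieldType) (l : nat) (D : {poly F}) :
  prime l -> D != 0 -> ~~ (l %| (size D).-1)%N ->
  exists (K : fieldExtType (FqT F)) (y : K),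
    [/\ \dim {:K} = l, y ^+ l = polyK K D & <<1; y>>%VS = fullv].
Proof.
move=> l_pr D0 lD; have l_gt0 := prime_gt0 l_pr.
have irr := XnsubC_irreducible l_gt0 (tofrac_exp_neq_exp l_pr D0 lD).
have [K dimK [y rt genK]] := irredp_FAdjoin irr.
exists K, y; split=> //; first by rewrite dimK size_XnsubC.
move: rt; rewrite rootE rmorphB /= map_polyXn map_polyC /= !hornerE subr_eq0.
by move/eqP.
Qed.

Lemma ext_iso_radical (F : finFieldType) (K1 K2 : fieldExtType (FqT F)) (l : nat)
    (D : {poly F}) (y : K1) :
  ext_iso K1 K2 -> y ^+ l = polyK K1 D -> exists x : K2, x ^+ l = polyK K2 D.
Proof.
case=> f [/ahom_inP[fM f1] _] yl; exists (f y).
have fX n : f (y ^+ n) = f y ^+ n.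
  by elim: n => [|n IHn]; rewrite ?expr0 // !exprS fM ?memvf // IHn.
by rewrite -fX yl linearZ /= f1.
Qed.

Theorem theorem5p5 (F : finFieldType) (g : {poly F}) (l : nat) :
  (2 < #|F|)%N ->
  (1 < size g)%N ->
  squarefree_poly g ->
  prime l -> (l %| #|F|.-1)%N ->
  (forall P : {poly F}, P \is monic -> irreducible_poly P -> P %| g ->
     ~~ ((size P).-1 %| (size g).-1)%N -> (size P).-1 = l) ->
  (* infinitely many (pairwise non-isomorphic) such extensions *)
  forall n : nat, exists Ks : 'I_n -> fieldExtType (FqT F),
    (forall i, cyclic_ext (Ks i) l /\ disc_coprime (Ks i) g /\
               carmichael_elt (polyK (Ks i) g)) /\
    (forall i j, i != j -> ~ ext_iso (Ks i) (Ks j)).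
Proof.
move=> _ g_gt1 sqfree l_pr lq degP n.
have l_gt0 := prime_gt0 l_pr; have l_gt1 := prime_gt1 l_pr.
have [z z_prim] := finField_prim_root l_gt0 lq.
have [D [goodD copD]] := coprime_family n g_gt1 l_gt1.
(* The degree of [P] divides [deg g] or equals [l]. The hypothesis speaks of monic factors, so [P]
   is first divided by its leading coefficient. *)
have irr_deg P : irreducible_poly P -> P %| g -> ((size P).-1 %| l * (size g).-1)%N.
  move=> P_irr Pg; have [P_gt1 P_min] := P_irr.
  have [dv|ndv] := boolP ((size P).-1 %| (size g).-1)%N; first exact: dvdn_mull.
  have c0 : (lead_coef P)^-1 != 0.
    by rewrite invr_eq0 lead_coef_eq0 -size_poly_gt0 ltnW.
  have szP := size_scale P c0; rewrite -szP dvdn_mulr // degP ?szP //.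
  - by rewrite monicE lead_coefZ mulVf // -invr_eq0.
  - split=> [|q q_n1]; rewrite ?szP // dvdpZr // => /(P_min q q_n1).
    by rewrite eqp_sym => /(eqp_trans (eqp_scale P c0)); rewrite eqp_sym.
  - by rewrite dvdpZl.
have g_frob r : g %| r ^+ (#|F| ^ (l * (size g).-1)) - r.
  apply: dvdp_squarefree => // P P_irr Pg.
  exact: irreducible_dvdp_Frobenius (irr_deg P P_irr Pg).
(* The last two clauses serve only to tell the fields apart: a radical of [D i] in [K], and the
   Kummer descent for all radicals of [K]. *)
have field_ex i : exists K : fieldExtType (FqT F),
    [/\ cyclic_ext K l /\ disc_coprime K g /\ carmichael_elt (polyK K g),
        exists y : K, y ^+ l = polyK K (D i)
      & forall (b : FqT F) (x : K), b != 0 -> x ^+ l = b%:A ->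
          exists c k, b = c ^+ l * frac_of (D i) ^+ k].
  have [D0 gD lD] := goodD i.
  have [K [y [dimK yl genK]]] := kummer_function_field_exists l_pr D0 lD.
  exists K; split; last 1 first.
  - exact: kummer_function_field_descent z_prim D0 dimK yl genK.
  - split; first exact: kummer_cyclic_ext z_prim D0 dimK yl genK.
    split; first exact: kummer_disc_coprime z_prim gD dimK yl genK.
    split; first exact: in_OK_polyK.
    exists (#|F| ^ (l * (size g).-1))%N; split.
      exact: kummer_quot_card z_prim D0 g_gt1 gD dimK yl genK.
    split; first exact: (kummer_quot_not_field z_prim D0 g_gt1 gD dimK yl genK).
    by move=> a; apply: (kummer_congr_exp z_prim gD dimK yl genK).
  - by exists y.
have [Ks Ks_good] := fin_all_exists field_ex.
exists Ks; split=> [i | i j ne_ij iso]; first by case: (Ks_good i).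
have [_ [y yl] _] := Ks_good i; have [_ _ descent] := Ks_good j.
have [Di0 _ lDi] := goodD i.
(* The isomorphism carries the radical of [D i] into [Ks j]; descent there relates [D i] to a power
   of the coprime [D j], forcing [l] to divide [deg (D i)]. *)
have [x xl] := ext_iso_radical iso yl.
have [|c [k Dc]] := descent (frac_of (D i)) x _ xl; first by rewrite tofrac_eq0.
by have := coprime_radical_degree l_gt0 Di0 (copD i j ne_ij) Dc; apply/negP.
Qed.
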